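(* Let $R$ be a finite commutative local ring with unity, and let $n=|R|$. Let $T_\Gamma(R)$ be the total graph of $R$. (1) If $2 \notin U(R)$, then $$SO(T_\Gamma(R)) = \frac{n(n-|U(R)|-1)^2}{\sqrt{2}}.$$ (2) If $2 \in U(R)$, then $$SO(T_\Gamma(R)) = \frac{(n-|U(R)|)(n-|U(R)|-1)^2}{\sqrt{2}}+\frac{|U(R)|\,(n-|U(R)|)^2}{\sqrt{2}}.$$
   Context: For a finite simple graph $G$, the Sombor index is $SO(G)=\sum_{uv\in E(G)}\sqrt{d_u^2+d_v^2}$, the sum being over (unordered) edges, where $d_x$ is the degree of the vertex $x$. For a commutative ring $R$ with unity, $Z(R)$ denotes the set of zero-divisors of $R$, including $0$, and $U(R)$ denotes the set of units of $R$; here $2=1+1\in R$. The total graph $T_\Gamma(R)$ is the simple graph whose vertices are all elements of $R$, with distinct vertices $x,y$ adjacent if and only if $x+y\in Z(R)$. *)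

(* Defs.v *)
From mathcomp Require Import all_boot all_order all_algebra.
From mathcomp Require Import reals.

Set Implicit Arguments.
Unset Strict Implicit.
Unset Printing Implicit Defensive.

Import Order.TTheory GRing.Theory Num.Theory.

Local Open Scope ring_scope.

Record sgraph (V : finType) := SGraph {
  adj : rel V;
  adj_sym : symmetric adj;
  adj_irr : irreflexive adj
}.

Definition deg (V : finType) (G : sgraph V) (x : V) : nat := #|adj G x|.

Definition edges (V : finType) (G : sgraph V) : {set {set V}} :=
  [set [set x; y] | x in V, y in V & adj G x y].

(* An edge e is the two-element set {u, v}, so the inner sum is
   d_u ^ 2 + d_v ^ 2. *)
Definition sombor (F : realType) (V : finType) (G : sgraph V) : F :=
  \sum_(e in edges G) Num.sqrt (\sum_(x in e) (deg G x)%:R ^+ 2).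

Definition zero_divisors (R : finComUnitRingType) : {set R} :=
  [set x | [exists y : R, (y != 0) && (x * y == 0)]].

Definition ring_units (R : finComUnitRingType) : {set R} :=
  [set x | x \is a GRing.unit].

(* [idealr_closed] includes properness (1 \notin I). *)
Definition maximal_ideal (R : finComUnitRingType) (M : {set R}) : Prop :=
  idealr_closed M /\
  forall I : {set R}, idealr_closed I -> M \subset I -> I = M.

Definition local_ring (R : finComUnitRingType) : Prop :=
  exists! M : {set R}, maximal_ideal M.

Definition total_adj (R : finComUnitRingType) : rel R :=
  fun x y => (x != y) && (x + y \in zero_divisors R).

Lemma total_adj_sym (R : finComUnitRingType) : symmetric (@total_adj R).
Proof. by move=> x y; rewrite /total_adj eq_sym addrC. Qed.

Lemma total_adj_irr (R : finComUnitRingType) : irreflexive (@total_adj R).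
Proof. by move=> x; rewrite /total_adj eqxx. Qed.

Definition total_graph (R : finComUnitRingType) : sgraph R :=
  SGraph (@total_adj_sym R) (@total_adj_irr R).

(* Main.v *)
(** In a local ring the zero divisors form the maximal ideal [M], so [x + y] in
    [M] forces [x] and [y] to lie both in [M] or both outside it. The neighbours
    of [x] are the elements of [M - x] other than [x], and [x] belongs to
    [M - x] exactly when [2 x] is in [M]. Hence adjacent vertices of the total
    graph have the same degree; for such a graph every edge [uv] contributes
    [sqrt 2 * d_u], so double counting gives [SO = (\sum_x d_x ^ 2) / sqrt 2]. *)
Require Import Defs.
From mathcomp Require Import all_boot all_order all_algebra.
From mathcomp Require Import reals.

Import Order.TTheory GRing.Theory Num.Theory.
Local Open Scope ring_scope.

(** An edge through [x] is determined by its other endpoint, which differs from [x] because [adj] is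
    irreflexive. *)
Lemma card_incident_edges {V : finType} (G : sgraph V) (x : V) :
  #|[set e in edges G | x \in e]| = deg G x.
Proof.
have -> : [set e in edges G | x \in e] = [set [set x; y] | y in adj G x].
  apply/setP=> e; rewrite inE; apply/andP/imsetP => [[] | [y xy ->]].
    case/imset2P=> a b _; rewrite inE => /andP[_ ab] ->.
    rewrite !inE => /orP[] /eqP ->; first by exists b.
    by exists a; [rewrite -topredE /= adj_sym | rewrite setUC].
  split; last by rewrite set21.
  by apply/imset2P; exists x y => //=; rewrite inE.
apply: card_in_imset => y z; rewrite -!topredE /= => xy xz eq_yz.
have: y \in [set x; z] by rewrite -eq_yz set22.
by rewrite !inE => /orP[] /eqP // yx; rewrite yx adj_irr in xy.
Qed.

Lemma sombor_locally_regular (F : realType) {V : finType} (G : sgraph V) :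
  (forall x y, adj G x y -> deg G x = deg G y) ->
  sombor F G = (\sum_x (deg G x)%:R ^+ 2) / Num.sqrt 2%:R.
Proof.
move=> reg; have s2_neq0 : Num.sqrt 2%:R != 0 :> F.
  by rewrite sqrtr_eq0 -ltNge ltr0n.
(* The weight [sqrt 2 * d] of an edge is shared equally between its endpoints, [d / sqrt 2] each, so
   that the sum can be regrouped by vertices. *)
have edgeE (e : {set V}) : e \in edges G ->
    Num.sqrt (\sum_(x in e) (deg G x)%:R ^+ 2) =
    \sum_(x in e) (deg G x)%:R / Num.sqrt 2%:R :> F.
  case/imset2P=> a b _; rewrite inE => /andP[_ ab] ->.
  have neq_ab : a \notin [set b].
    by rewrite inE; apply/eqP=> eq_ab; rewrite eq_ab adj_irr in ab.
  rewrite !big_setU1 //= !big_set1 (reg _ _ ab) -!mulr2n.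
  rewrite -[_ ^+ 2 *+ 2]mulr_natl -[_ / _ *+ 2]mulr_natl.
  rewrite sqrtrM ?ler0n // sqrtr_sqr ger0_norm ?ler0n //.
  rewrite mulrC [RHS]mulrCA; congr (_ * _); apply: (mulIf s2_neq0).
  by rewrite divfK // -expr2 sqr_sqrtr ?ler0n.
(* With the vertex sum outside, the share of [x] is counted once per incident edge, hence [deg G x]
   times. *)
rewrite /sombor (eq_bigr _ edgeE) (exchange_big_dep xpredT) //= mulr_suml.
apply: eq_bigr => x _; rewrite sumr_const -[LHS]mulr_natl.
have -> : #|[pred e | e \in edges G & x \in e]| = deg G x.
  by rewrite -card_incident_edges; apply: eq_card => e; rewrite !inE.
by rewrite mulrA expr2.
Qed.

(** Finiteness is the point: if no nonzero element kills [x], multiplication by [x] is injective,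
    hence surjective, and reaches 1. *)
Lemma zero_divisorsE (R : finComUnitRingType) :
  zero_divisors R = ~: ring_units R.
Proof.
apply/setP=> x; rewrite !inE; apply/existsP/idP => [[y /andP[y0 /eqP xy0]] | ].
  by apply: contra y0 => xU; rewrite -(mulKr xU y) xy0 mulr0.
move=> xNU; apply/existsP; apply: contraNT xNU => no_ann.
have inj_x : injective ( *%R x).
  move=> y z eq_yz; apply/eqP; rewrite -subr_eq0; apply: contraNT no_ann.
  move=> yz0; apply/existsP; exists (y - z).
  by rewrite yz0 mulrBr eq_yz subrr eqxx.
have /codomP[y xy1] : 1 \in codom ( *%R x) by rewrite injF_onto.
by apply/unitrP; exists y; rewrite mulrC -xy1.
Qed.

(** A boolean form of [idealr_closed], so that [maxset] applies to it. *)
Definition proper_idealb {R : finComUnitRingType} (I : {set R}) : bool :=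
  [&& 0 \in I, 1 \notin I &
      [forall a, [forall x in I, [forall y in I, a * x + y \in I]]]].

Lemma proper_idealP {R : finComUnitRingType} (I : {set R}) :
  reflect (idealr_closed I) (proper_idealb I).
Proof.
apply: (iffP and3P) => [[I0 I1 /forallP IDM] | [I0 I1 IDM]]; split=> //.
  move=> a x y xI yI.
  by move/forall_inP: (IDM a) => /(_ x xI) /forall_inP /(_ y yI).
by apply/forallP=> a; apply/forall_inP=> x xI; apply/forall_inP=> y; apply: IDM.
Qed.

(** The principal ideal of a nonunit is proper, and finiteness lets it grow to a maximal one without
    Zorn's lemma. *)
Lemma nonunit_in_maximal_ideal {R : finComUnitRingType} (x : R) :
  x \isn't a GRing.unit -> exists2 M : {set R}, maximal_ideal M & x \in M.
Proof.
move=> xNU; pose I := [set x * a | a in [set: R]].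
have I_ideal : proper_idealb I.
  apply/proper_idealP; split=> [||a _ _ /imsetP[b _ ->] /imsetP[c _ ->]].
  - by apply/imsetP; exists 0; rewrite ?inE ?mulr0.
  - apply: contra xNU => /imsetP[a _ xa1].
    by apply/unitrP; exists a; rewrite mulrC -xa1.
  - by apply/imsetP; exists (a * b + c); rewrite ?inE // mulrDr mulrCA.
have [M /maxsetP[/proper_idealP M_ideal maxM] sIM] := maxset_exists I_ideal.
exists M; first by split=> // J /proper_idealP; apply: maxM.
by apply: (subsetP sIM); apply/imsetP; exists 1; rewrite ?inE ?mulr1.
Qed.

(** Every nonunit lies in some maximal ideal, which must be the unique one [M]; conversely a unit in
    [M] would put 1 there. *)
Lemma local_zero_divisors_ideal (R : finComUnitRingType) :
  local_ring R -> idealr_closed (zero_divisors R).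
Proof.
case=> M [[M_ideal _] uniqM]; suff -> : zero_divisors R = M by [].
rewrite zero_divisorsE; apply/setP=> x; rewrite !inE; apply/idP/idP.
  by case/nonunit_in_maximal_ideal=> N /uniqM <-.
case: M_ideal => M0 M1 MDM xM; apply: contra M1 => xU.
by rewrite -(mulVr xU) -[_ * _]addr0 MDM.
Qed.

Section LocalTotalGraph.

Variable R : finComUnitRingType.
Hypothesis R_local : local_ring R.

Local Notation Z := (zero_divisors R).

Lemma zero_divisorsM (a x : R) : x \in Z -> a * x \in Z.
Proof.
have [Z0 _ ZDM] := local_zero_divisors_ideal R R_local.
by move=> xZ; rewrite -[_ * _]addr0 ZDM.
Qed.

Lemma zero_divisorsDl (x y : R) : x + y \in Z -> (x \in Z) = (y \in Z).
Proof.
have [_ _ ZDM] := local_zero_divisors_ideal R R_local.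
move=> xyZ; apply/idP/idP => [xZ | yZ].
  by rewrite -[y](addKr x) -mulN1r ZDM.
by rewrite -[x](addrK y) addrC -mulN1r ZDM.
Qed.

Lemma deg_total_graph (x : R) :
  deg (total_graph R) x = (#|Z| - (x *+ 2 \in Z))%N.
Proof.
(* Translation by [- x] carries [Z] bijectively onto this set. *)
have -> : #|Z| = #|[set y | x + y \in Z]|.
  rewrite -(card_imset _ (addrI (- x))); apply: eq_card => y; rewrite inE.
  apply/imsetP/idP => [[z zZ ->] | xyZ]; first by rewrite addNKr.
  by exists (x + y); rewrite ?addKr.
rewrite (cardsD1 x) inE -mulr2n addKn.
by apply: eq_card => y; rewrite !inE unfold_in /= /total_adj inE eq_sym.
Qed.

(** [Z] is an ideal whose complement, the units, is closed under products, so it acts as a prime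
    ideal on [2 * x]. *)
Lemma double_in_zero_divisors (x : R) :
  (x *+ 2 \in Z) = (2%:R \in Z) || (x \in Z).
Proof.
apply/idP/orP => [ | [] xZ]; last 2 first.
- by rewrite -mulr_natr zero_divisorsM.
- by rewrite -mulr_natl zero_divisorsM.
rewrite zero_divisorsE !inE -[x *+ 2]mulr_natl unitrM negb_and.
exact/orP.
Qed.

Lemma total_graph_locally_regular (x y : R) :
  adj (total_graph R) x y -> deg (total_graph R) x = deg (total_graph R) y.
Proof.
case/andP=> _ /zero_divisorsDl eq_xy.
by rewrite !deg_total_graph [x *+ 2 \in _]double_in_zero_divisors
           [y *+ 2 \in _]double_in_zero_divisors eq_xy.
Qed.

End LocalTotalGraph.

Theorem theorem5p1 (F : realType) (R : finComUnitRingType)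
    (hR : local_ring R) :
  let n : F := #|R|%:R in
  let u : F := #|ring_units R|%:R in
  ((2%:R : R) \notin ring_units R ->
     sombor F (total_graph R) = n * (n - u - 1) ^+ 2 / Num.sqrt 2%:R) /\
  ((2%:R : R) \in ring_units R ->
     sombor F (total_graph R) =
       (n - u) * (n - u - 1) ^+ 2 / Num.sqrt 2%:R +
       u * (n - u) ^+ 2 / Num.sqrt 2%:R).
Proof.
move=> n u.
have cardZ : #|zero_divisors R|%:R = n - u.
  by rewrite zero_divisorsE /n -(cardsC (ring_units R)) natrD addrAC subrr add0r.
(* Ensures that the natural-number subtraction in [deg_total_graph] does not truncate when cast to
   [F]. *)
have Z_gt0 : (0 < #|zero_divisors R|)%N.
  have [Z0 _ _] := local_zero_divisors_ideal R hR.
  by apply/card_gt0P; exists 0.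
have degE x : (deg (total_graph R) x)%:R =
    n - u - ((2%:R \notin ring_units R) || (x \in zero_divisors R))%:R :> F.
  rewrite deg_total_graph // natrB; last by apply: leq_trans Z_gt0; case: (_ \in _).
  by rewrite cardZ double_in_zero_divisors // {1}zero_divisorsE inE.
rewrite sombor_locally_regular; last exact: total_graph_locally_regular.
under eq_bigr do rewrite degE.
(* If 2 is not a unit, the indicator in [degE] is constantly 1 and the graph is regular. Otherwise
   it is 1 on the zero divisors and 0 on the units, and the sum splits accordingly. *)
split=> [-> | ->] /=; first by rewrite sumr_const -[_ *+ #|_|]mulr_natl.
rewrite (bigID [in zero_divisors R]) /= -mulrDl; congr ((_ + _) / _).
  under eq_bigr => x -> do [].
  by rewrite sumr_const -[_ *+ #|_|]mulr_natl cardZ.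
under eq_bigr => x /negbTE -> do rewrite subr0.
rewrite sumr_const -[_ *+ #|_|]mulr_natl; congr (_%:R * _).
by apply: eq_card => x; rewrite zero_divisorsE -topredE /= inE negbK.
Qed.
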